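(* Let $\mathrm{SNR}>0$ and let $z_1, z_2, \ldots$ be i.i.d. nonnegative random variables (the squared magnitudes $z_i=|h_i|^2$ of block-fading channel coefficients). Fix a transmission rate $R>0$ (bit/s/Hz) and define the random transmission time of a message under HARQ with incremental redundancy as $$T=\min\Big\{M\ge 1: R<\sum_{i=1}^{M}\log_2(1+\mathrm{SNR}\, z_i)\Big\}.$$ Let $T_1,T_2,\ldots$ be i.i.d. copies of $T$ (the durations of successful transmissions of consecutive messages), let $N_t=\max\{k: \sum_{l=1}^{k}T_l<t\}$ be the associated renewal counting process, and for $\theta>0$ define the effective capacity $$C_e(\theta)=-\lim_{t\to\infty}\frac{1}{\theta t}\log_e \mathbb{E}\{e^{-\theta R N_t}\}.$$ Let $\mu_1=\mathbb{E}\{T\}$ and $\sigma^2=\mathrm{var}(T)$ (both depending on $R$). Then, as $\theta\to 0$, $$C_e(\theta)=\frac{R}{\mu_1}-\frac{R^2\sigma^2}{2\mu_1^3}\,\theta+o(\theta),$$ where $o(\theta)$ denotes terms with $\lim_{\theta\to 0} o(\theta)/\theta=0$.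
   Context: The model is the block-fading channel $\mathbf{y}_i=h_i\mathbf{x}_i+\mathbf{n}_i$ with instantaneous capacity $C_i=\log_2(1+\mathrm{SNR}\,z_i)$ in block $i$. In HARQ-IR the receiver accumulates mutual information over blocks and decodes a message at the end of block $M$ exactly when $R<\sum_{i=1}^M C_i$; then a new message starts. $\theta$ is the QoS exponent (decay rate of the buffer overflow probability), and $S_t=RN_t$ is the number of bits served by time $t$. *)

(* Defs.v *)
From HB Require Import structures.
From mathcomp Require Import all_boot all_order all_algebra.
From mathcomp Require Import all_classical all_reals all_analysis.
Set Implicit Arguments. Unset Strict Implicit. Unset Printing Implicit Defensive.
Import Order.TTheory GRing.Theory Num.Theory.
Import numFieldNormedType.Exports.
Local Open Scope classical_set_scope.
Local Open Scope ring_scope.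

Definition log2 {R : realType} (x : R) : R := ln x / ln 2.

(** accumulated mutual information after M blocks; block i of the paper
    (i >= 1) is index i-1 here. *)
Definition acc_info {R : realType} (SNR : R) (z : nat -> R) (M : nat) : R :=
  \sum_(i < M) log2 (1 + SNR * z i).

(** HARQ-IR transmission time T = min {M >= 1 : Rate < sum_{i=1}^M C_i};
    default value 0 when no such M exists. *)
Definition harq_time {R : realType} (Rate SNR : R) (z : nat -> R) : nat :=
  match pselect (exists M, (1 <= M)%N /\ Rate < acc_info SNR z M) with
  | left h => ex_minn (P := fun M => (1 <= M)%N && (Rate < acc_info SNR z M))
                (let: ex_intro M (conj h1 h2) := h in
                 ex_intro _ M (introT andP (conj h1 (introT idP h2))))
  | right _ => 0%N
  end.

(** renewal counting process N_t = max {k : sum_{l=1}^k T_l < t};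
    default value 0 when the maximum does not exist. *)
Definition renewal_count {R : realType} (T : nat -> nat) (t : R) : nat :=
  match pselect (exists k, ((\sum_(l < k) T l)%:R < t) /\
                   forall j, ((\sum_(l < j) T l)%:R < t) -> (j <= k)%N) with
  | left h => projT1 (cid h)
  | right _ => 0%N
  end.

Definition mutually_independent_R {d} {Om : measurableType d} {R : realType}
  (P : probability Om R) (X : nat -> Om -> R) : Prop :=
  forall (I : seq nat) (A : nat -> set R), uniq I ->
    (forall i, measurable (A i)) ->
    P (\bigcap_(i in [set` I]) (X i @^-1` A i)) =
    (\prod_(i <- I) P (X i @^-1` A i))%E.

Definition mutually_independent_nat {d} {Om : measurableType d} {R : realType}
  (P : probability Om R) (X : nat -> Om -> nat) : Prop :=
  forall (I : seq nat) (A : nat -> set nat), uniq I ->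
    P (\bigcap_(i in [set` I]) (X i @^-1` A i)) =
    (\prod_(i <- I) P (X i @^-1` A i))%E.

(* Main.v *)
(** Let [p n = P(T = n)] and [phi s = E e^{s T}].  Conditioning on [T_1], the Laplace transform
    [u n = E e^{-a N_n}] satisfies the renewal equation
    [u n = P(T >= n) + e^{-a} sum_{j < n} p j * u (n - j)].  By induction on [n] it gives
    [u n <= e^a e^{-s n}] whenever [phi s <= e^a], and [u n >= c e^{-s n}] as soon as some partial
    sum of the series [phi s] reaches [e^a].  Hence [- ln (u n) / n] tends to the root [s(a)] of
    [phi s = e^a], so [Ce theta = s(theta Rate) / theta], and comparing the second-order Taylor
    bounds of [phi] and [exp] gives [s(a) = a / mu - sigma^2 a^2 / (2 mu^3) + o(a^2)].  All this
    needs an exponential moment of [T]: with [c > 0] such that a block carries more than [c] bits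
    with probability [q > 0], [T > n] forces fewer than [K ~ Rate / c] such blocks among the first
    [n], an event of probability at most [2^K (1 - q / 2)^n]. *)

Require Import Defs.
From HB Require Import structures.
From mathcomp Require Import all_boot all_order all_algebra.
From mathcomp Require Import all_classical all_reals all_analysis.
From mathcomp Require Import measurable_realfun ring lra.
Set Implicit Arguments.
Unset Strict Implicit.
Import Order.TTheory GRing.Theory Num.Theory.
Import numFieldNormedType.Exports.
Local Open Scope classical_set_scope.
Local Open Scope ring_scope.

(** * The renewal equation *)

(** Induction on [n]: the bound at [n - j] turns the convolution into [e^{-sn}] times a partial sum
    of [p j e^{sj}], and the tail term supplies what that partial sum lacks to reach [e^a]. *)
Lemma renewal_eq_le (R : realType) (p u : nat -> R) (a s : R) :
  (forall n, 0 <= p n) -> p 0%N = 0 -> series p @ \oo --> (1 : R) -> 0 <= s ->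
  (forall n, (0 < n)%N -> u n = 1 - series p n +
     expR (- a) * \sum_(0 <= j < n) p j * u (n - j)%N) ->
  (forall n, series (fun j => p j * expR (s * j%:R)) n <= expR a) ->
  forall n, (0 < n)%N -> u n <= expR a * expR (- (s * n%:R)).
Proof.
move=> p0 p00 p1 s0 uE phile.
(* Markov's inequality: [p j <= e^{-sn} p j e^{sj}] for [j >= n], and these weighted terms sum to at
   most [e^a] minus the partial sum. *)
have tail n : 1 - series p n <=
    expR (- (s * n%:R)) * (expR a - series (fun j => p j * expR (s * j%:R)) n).
  rewrite lerBlDr.
  rewrite -[leLHS](cvg_lim _ p1)//; apply: limr_le; first exact: cvgP p1.
  near=> N; have nN : (n <= N)%N by near: N; exists n.
  rewrite -lerBlDr sub_series_geq// -ler_pdivrMl ?expR_gt0// -expRN opprK lerBrDl.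
  apply: le_trans (phile N).
  rewrite /series/= (@big_cat_nat _ _ _ n 0 N)//= lerD2l big_distrr/=.
  rewrite !big_nat; apply: ler_sum => j /andP[nj _].
  by rewrite mulrC ler_wpM2l// ler_expR ler_wpM2l// ler_nat.
elim/ltn_ind => n IH n0; rewrite uE//.
apply: (le_trans (lerD (tail n) (_ : _ <= expR (- (s * n%:R)) *
   series (fun j => p j * expR (s * j%:R)) n))); last first.
  by rewrite -mulrDr subrK mulrC.
rewrite /series/= !big_distrr/= !big_nat; apply: ler_sum => j /= jn.
have [->|j0] := posnP j; first by rewrite p00 !(mul0r,mulr0).
have := IH (n - j)%N; rewrite ltn_subrL j0 n0 subn_gt0 jn => /(_ isT isT) h.
rewrite mulrCA [leRHS]mulrCA ler_wpM2l//.
apply: le_trans (ler_wpM2l (expR_ge0 _) h) _.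
rewrite -!expRD ler_expR natrB 1?ltnW//; lra.
Unshelve. all: by end_near. Qed.

(** The crude bound [u n >= e^{-an}] settles [n < K] and fixes the constant [e^{-aK}]. For [n >= K],
    dropping the tail and the terms [j >= K] leaves a finite sum to which induction and the
    hypothesis on [K] apply. *)
Lemma renewal_eq_ge (R : realType) (p u : nat -> R) (a s : R) (K : nat) :
  (forall n, 0 <= p n) -> p 0%N = 0 -> (forall n, series p n <= 1) ->
  0 <= a -> 0 <= s ->
  (forall n, (0 < n)%N -> u n = 1 - series p n +
     expR (- a) * \sum_(0 <= j < n) p j * u (n - j)%N) ->
  expR a <= series (fun j => p j * expR (s * j%:R)) K ->
  forall n, (0 < n)%N -> expR (- (a * K%:R)) * expR (- (s * n%:R)) <= u n.
Proof.
move=> p0 p00 p1 a0 s0 uE phige.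
(* The analytic form of [N_n <= n]: since [p 0 = 0], each renewal advances time by at least one. *)
have crude n : (0 < n)%N -> expR (- (a * n%:R)) <= u n.
  elim/ltn_ind: n => n IH n0; rewrite uE//.
  have e1 : expR (- (a * n%:R)) <= 1.
    by rewrite -expR0 ler_expR oppr_le0 mulr_ge0.
  have h1 : (1 - series p n) * expR (- (a * n%:R)) <= 1 - series p n.
    by rewrite ler_piMr// subr_ge0.
  suff h2 : series p n * expR (- (a * n%:R)) <=
      expR (- a) * \sum_(0 <= j < n) p j * u (n - j)%N.
    by apply: le_trans (lerD h1 h2); rewrite -mulrDl subrK mul1r.
  rewrite /series/= big_distrr big_distrl/= !big_nat; apply: ler_sum => j /= jn.
  have [->|j0] := posnP j; first by rewrite p00 !(mul0r,mulr0).
  have := IH (n - j)%N; rewrite ltn_subrL j0 n0 subn_gt0 jn => /(_ isT isT) h.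
  rewrite mulrCA ler_wpM2l//.
  apply: le_trans (ler_wpM2l (expR_ge0 _) h).
  rewrite -!expRD ler_expR natrB 1?ltnW// mulrBr.
  have : a * 1 <= a * j%:R by rewrite ler_wpM2l// ler1n.
  lra.
elim/ltn_ind => n IH n0.
have [nK|Kn] := ltnP n K.
  apply: le_trans (crude n n0); rewrite -expRD ler_expR.
  have : a * n%:R <= a * K%:R by rewrite ler_wpM2l// ler_nat ltnW.
  have : 0 <= s * n%:R by rewrite mulr_ge0.
  lra.
rewrite uE// -[leLHS]add0r lerD ?subr_ge0//.
rewrite -ler_pdivrMl ?expR_gt0// -expRN opprK.
rewrite mulrC; apply: (le_trans (ler_wpM2l _ phige)).
  by rewrite mulr_ge0 ?expR_ge0.
rewrite (@big_cat_nat _ _ _ K 0)//= -[leLHS]addr0 lerD//; last first.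
  rewrite big_nat sumr_ge0// => j /andP[_ jn].
  rewrite mulr_ge0//; apply: le_trans (crude _ _); rewrite ?expR_ge0//.
  by rewrite subn_gt0.
rewrite /series/= big_distrr/= !big_nat; apply: ler_sum => j /= jK.
have [->|j0] := posnP j; first by rewrite p00 !(mul0r,mulr0).
have jn : (j < n)%N by exact: leq_trans Kn.
have := IH (n - j)%N; rewrite ltn_subrL j0 n0 subn_gt0 jn => /(_ isT isT) h.
rewrite mulrCA ler_wpM2l//; apply: le_trans h.
rewrite -!expRD ler_expR natrB 1?ltnW//; lra.
Qed.

(** * Inverting a moment generating function to second order *)

Lemma expR_ge_deg2 (R : realType) (x : R) : 0 <= x -> 1 + x + x ^+ 2 / 2 <= expR x.
Proof.
move=> x0; rewrite /expR.
have := @nondecreasing_cvgn_le R (series (exp_coeff x)) _ (is_cvg_series_exp_coeff x) 3.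
have nd : nondecreasing_seq (series (exp_coeff x)).
  by apply: nondecreasing_series => n _ _; exact: exp_coeff_ge0.
move=> /(_ nd); apply: le_trans.
rewrite /series/= /exp_coeff/= !big_nat_recl//= big_geq// !factS fact0.
by rewrite expr0 expr1 !divr1 addr0 addrA.
Qed.

(** The terms from degree 3 on are [x^3 x^k / (k + 3)!], and [(k + 3)! >= k!]. *)
Lemma expR_le_deg2 (R : realType) (x : R) :
  0 <= x -> expR x <= 1 + x + x ^+ 2 / 2 + x ^+ 3 * expR x.
Proof.
move=> x0; rewrite {1}/expR; apply: limr_le; first exact: is_cvg_series_exp_coeff.
near=> n; have n3 : (3 <= n)%N by near: n; exists 3.
rewrite -(subnK n3); set m := (n - 3)%N.
have nd : nondecreasing_seq (series (exp_coeff x)).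
  by apply: nondecreasing_series => k _ _; exact: exp_coeff_ge0.
have sm := @nondecreasing_cvgn_le R _ nd (is_cvg_series_exp_coeff x) m.
apply: le_trans (lerD (lexx _) (ler_wpM2l (exprn_ge0 3 x0) sm)).
rewrite /series/= (@big_cat_nat _ _ _ 3 0)//= ?leq_addl// lerD//.
  rewrite /exp_coeff/= !big_nat_recl//= big_geq// !factS fact0.
  by rewrite expr0 expr1 !divr1 addr0 addrA.
rewrite -{1}[3%N]add0n big_addn addnK big_distrr/=; apply: ler_sum => k _.
rewrite /exp_coeff/= mulrA -exprD [(3 + k)%N]addnC ler_wpM2l ?exprn_ge0//.
by rewrite lef_pV2 ?posrE ?ltr0n ?fact_gt0// ler_nat leq_fact// leq_addr.
Unshelve. all: by end_near. Qed.

Lemma cube_le_expR (R : realType) (x : R) : 0 <= x -> x ^+ 3 <= 6 * expR x.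
Proof. by move=> x0; have := expR_ge1Dxn 2 x0; rewrite !factS fact0; lra. Qed.

(** The root in [[0, b]] of [phi s = expR a], as a supremum so that continuity of [phi] is never
    needed. *)
Definition mgf_root {R : realType} (phi : R -> R) (b a : R) : R :=
  sup [set s | 0 <= s <= b /\ phi s <= expR a].

Section root.
Context (R : realType) (phi : R -> R) (b mu m2 B : R).
Hypothesis b0 : 0 < b.
Hypothesis mu0 : 0 < mu.
Hypothesis m20 : mu ^+ 2 <= m2.
Hypothesis B0 : 0 <= B.
Hypothesis phi0 : phi 0 = 1.
Hypothesis phi_nd : forall s t, 0 <= s -> s <= t -> t <= b -> phi s <= phi t.
Hypothesis phi_ge : forall s, 0 <= s <= b -> 1 + mu * s + m2 * s ^+ 2 / 2 <= phi s.
Hypothesis phi_le : forall s, 0 <= s <= b ->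
  phi s <= 1 + mu * s + m2 * s ^+ 2 / 2 + B * s ^+ 3.

Let S a := [set s | 0 <= s <= b /\ phi s <= expR a].

Let hasS a : 0 <= a -> has_sup (S a).
Proof.
move=> a0; split; first by exists 0; split; [rewrite lexx ltW|rewrite phi0 -[leLHS]expR0 ler_expR].
by exists b => s [/andP[]].
Qed.

Lemma mgf_root_le a s : 0 <= a -> 0 <= s <= b -> expR a < phi s -> mgf_root phi b a <= s.
Proof.
move=> a0 /andP[s0 sb] h; apply: ge_sup => [|t [/andP[t0 tb] pt]].
  by have [] := hasS a0.
rewrite leNgt; apply/negP => st; have := phi_nd s0 (ltW st) tb; lra.
Qed.

Lemma mgf_root_ge a s : 0 <= a -> 0 <= s <= b -> phi s <= expR a -> s <= mgf_root phi b a.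
Proof. by move=> a0 s0b h; apply: ub_le_sup => //; have [] := hasS a0. Qed.

(** Keeps the root at distance [b / 2] from the end of the interval, so that [phi] can still be
    evaluated to its right. *)
Lemma mgf_root_half a : 0 <= a -> expR a < 1 + mu * (b / 2) -> mgf_root phi b a <= b / 2.
Proof.
move=> a0 h; have hb : 0 <= b / 2 <= b by have := b0; move=> ?; apply/andP; split; lra.
apply: mgf_root_le => //; apply: lt_le_trans h _.
apply: le_trans (phi_ge hb); rewrite lerDl.
by rewrite divr_ge0// mulr_ge0 ?sqr_ge0// (le_trans _ m20)// sqr_ge0.
Qed.

(** With the next lemma, stands in for the equation [phi s = e^a] at the root. *)
Lemma mgf_le_below_root a s : 0 <= a -> 0 <= s -> s < mgf_root phi b a -> phi s <= expR a.
Proof.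
move=> a0 s0 h.
have [t [/andP[t0 tb] pt] st] := sup_gt (proj1 (hasS a0)) h.
by apply: le_trans pt; apply: phi_nd => //; exact: ltW.
Qed.

Lemma mgf_gt_above_root a s : 0 <= a -> mgf_root phi b a < s -> s <= b -> expR a < phi s.
Proof.
move=> a0 h sb; rewrite ltNge; apply/negP => ps.
have r0 : 0 <= mgf_root phi b a.
  by apply: mgf_root_ge => //; [rewrite lexx ltW|rewrite phi0 -[leLHS]expR0 ler_expR].
have : s <= mgf_root phi b a.
  by apply: mgf_root_ge => //; rewrite sb andbT; exact: le_trans (ltW h).
lra.
Qed.

Let small (K k : R) : 0 < k -> \forall x \near 0^'+, K * x < k.
Proof.
move=> k0; near=> x.
have x0 : 0 < x by [].
have xk : x < k / (`|K| + 1).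
  near: x; apply: nbhs_right_lt; rewrite divr_gt0// ltr_wpDl//.
have K1 : 0 < `|K| + 1 by rewrite ltr_wpDl.
apply: le_lt_trans (_ : (`|K| + 1) * x < k); last by rewrite mulrC -ltr_pdivlMr.
rewrite ler_wpM2r ?ltW//; have := ler_norm K; lra.
Unshelve. all: by end_near. Qed.

(** Put [x = a / mu] and test [phi] at [x - c x^2 +/- e x^2]. Since [m2 / 2 - mu c = mu^2 / 2], the
    expansions of [phi] there and of [e^a] agree to second order up to [+/- mu e x^2], which beats
    all cubic errors for small [a]. The sign decides on which side of the root the test point
    lies. *)
Lemma mgf_root_expansion : forall e, 0 < e -> \forall a \near 0^'+,
  `|mgf_root phi b a - (a / mu - (m2 - mu ^+ 2) / (2 * mu ^+ 3) * a ^+ 2)| <= e * a ^+ 2.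
Proof.
move=> eps eps0.
set c := (m2 - mu ^+ 2) / (2 * mu); set e := eps * mu ^+ 2.
have mun : mu != 0 by rewrite gt_eqF.
have c0 : 0 <= c by rewrite /c divr_ge0 ?subr_ge0// mulr_ge0// ltW.
have e0 : 0 < e by rewrite /e mulr_gt0// exprn_gt0.
have near_x K k : 0 < k -> \forall a \near 0^'+, K * (a / mu) < k.
  move=> k0; near=> a'; rewrite mulrCA mulrC.
  by near: a'; exact: small.
near=> a.
have a0 : 0 < a by [].
have a1 : a < 1.
  by near: a; exact: nbhs_right_lt.
(* [h1] makes the lower test point nonnegative, [h2] and [h2'] keep the upper one within [b], [h3]
   absorbs the cubic term of [phi_le], and [h4] absorbs the cubic losses in [m2 s^2 / 2] and in the
   remainder of [expR]. *)
have h1 : (c + e) * (a / mu) < 1 by near: a; exact: near_x.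
have h2 : (1 + e) * (a / mu) < b by near: a; exact: near_x.
have h2' : 1 * (a / mu) < 1 by near: a; exact: near_x.
have h3 : B * (a / mu) < mu * e by near: a; apply: near_x; rewrite mulr_gt0.
have h4 : (m2 * c + mu ^+ 3 * expR 1) * (a / mu) < mu * e.
  by near: a; apply: near_x; rewrite mulr_gt0.
have x0 : 0 < a / mu by rewrite divr_gt0.
have ax : a = mu * (a / mu) by rewrite mulrC divfK.
set x := a / mu in h1 h2 h2' h3 h4 x0 ax.
have -> : a / mu - (m2 - mu ^+ 2) / (2 * mu ^+ 3) * a ^+ 2 = x - c * x ^+ 2.
  by rewrite /x /c; field.
have -> : eps * a ^+ 2 = e * x ^+ 2 by rewrite /x /e; field.
have xx : 0 <= x ^+ 2 by exact: sqr_ge0.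
have cx : 0 <= c * x ^+ 2 by rewrite mulr_ge0.
have ex : 0 <= e * x ^+ 2 by rewrite mulr_ge0// ltW.
have xx1 : x ^+ 2 <= x by rewrite expr2 ler_piMl// ltW// -[ltLHS]mul1r.
have exx : e * x ^+ 2 <= e * x by rewrite ler_wpM2l// ltW.
have cex : (c + e) * x ^+ 2 <= x.
  by rewrite expr2 mulrA ler_piMl// ltW.
have mc : mu * c = (m2 - mu ^+ 2) / 2 by rewrite /c; field.
have m2p : 0 <= m2 by rewrite (le_trans _ m20)// sqr_ge0.
rewrite ler_distl; apply/andP; split.
- set s := _ - _.
  have s0 : 0 <= s by rewrite /s; lra.
  have sx : s <= x by rewrite /s; lra.
  have sb : s <= b by lra.
  apply: mgf_root_ge; [exact: ltW|by rewrite s0|].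
  apply: le_trans (phi_le _) _; first by rewrite s0.
  apply: le_trans (expR_ge_deg2 (ltW a0)).
  have s2 : m2 * s ^+ 2 <= m2 * x ^+ 2 by rewrite ler_wpM2l// ler_pXn2r// nnegrE// ltW.
  have s3 : B * s ^+ 3 <= B * x ^+ 3 by rewrite ler_wpM2l// ler_pXn2r// nnegrE// ltW.
  have h3' : B * x ^+ 3 <= mu * e * x ^+ 2.
    by rewrite exprS mulrA ler_wpM2r// ltW.
  have -> : a ^+ 2 = mu ^+ 2 * x ^+ 2 by rewrite ax; ring.
  have mcx : mu * s = mu * x - (m2 - mu ^+ 2) / 2 * x ^+ 2 - mu * e * x ^+ 2.
    by rewrite -mc /s; ring.
  rewrite [in leRHS]ax mcx; lra.
- set s := _ + _.
  have s0 : x - c * x ^+ 2 <= s by rewrite /s; lra.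
  have s00 : 0 <= x - c * x ^+ 2 by lra.
  have sb : s <= b by rewrite /s; lra.
  have sp : 0 <= s <= b by rewrite sb andbT; exact: le_trans s0.
  apply: mgf_root_le; [exact: ltW|by []|].
  apply: lt_le_trans (phi_ge sp).
  apply: le_lt_trans (expR_le_deg2 (ltW a0)) _.
  (* [s^2] is bounded below by [(x - c x^2)^2] without its quartic term, at a cost of order
     [x^3]. *)
  have s2 : m2 * (x ^+ 2 - 2 * c * x ^+ 3) <= m2 * s ^+ 2.
    rewrite ler_wpM2l//; apply: (le_trans (_ : _ <= (x - c * x ^+ 2) ^+ 2)).
      have -> : (x - c * x ^+ 2) ^+ 2 = x ^+ 2 - 2 * c * x ^+ 3 + (c * x ^+ 2) ^+ 2 by ring.
      by rewrite lerDl sqr_ge0.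
    by rewrite ler_pXn2r// nnegrE// (le_trans s00).
  have h5 : a ^+ 3 * expR a <= (mu ^+ 3 * expR 1) * x ^+ 3.
    rewrite ax exprMn mulrAC -ax; rewrite ler_wpM2r ?exprn_ge0 ?(ltW x0)//.
    by rewrite ler_wpM2l ?exprn_ge0 ?(ltW mu0)// ler_expR ltW.
  have h4' : (m2 * c + mu ^+ 3 * expR 1) * x ^+ 3 < mu * e * x ^+ 2.
    by rewrite [x ^+ 3]exprS mulrA ltr_pM2r// exprn_gt0.
  have -> : a ^+ 2 = mu ^+ 2 * x ^+ 2 by rewrite ax; ring.
  have mcx : mu * s = mu * x - (m2 - mu ^+ 2) / 2 * x ^+ 2 + mu * e * x ^+ 2.
    by rewrite -mc /s; ring.
  rewrite mcx {1}ax; lra.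
Unshelve. all: by end_near. Qed.
End root.

(** * Effective capacity of a light-tailed renewal process *)

Definition mgf {R : realType} (p : nat -> R) (s : R) : R :=
  limn (series (fun n => p n * expR (s * n%:R))).

Definition moment {R : realType} (p : nat -> R) (k : nat) : R :=
  limn (series (fun n => p n * n%:R ^+ k)).

Section light_tail.
Context (R : realType) (p : nat -> R) (b : R).
Hypothesis p0 : forall n, 0 <= p n.
Hypothesis b0 : 0 < b.
Hypothesis p1 : series p @ \oo --> (1 : R).
Hypothesis pb : cvgn (series (fun n => p n * expR ((b + b) * n%:R))).

Lemma cvg_series_expR_dominated (f : nat -> R) (K : R) :
  (forall n, 0 <= f n <= K * expR ((b + b) * n%:R)) -> cvgn (series (fun n => p n * f n)).
Proof.
move=> fK.
have Kf n : (K *: (fun n : nat => p n * expR ((b + b) * n%:R))) n =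
    p n * (K * expR ((b + b) * n%:R)) by rewrite -[LHS]/(K * (p n * _)) mulrCA.
apply: (series_le_cvg _ _ _ (is_cvg_seriesZ (k := K) pb)) => n /=; rewrite ?Kf;
  have /andP[f0 fKn] := fK n.
- by rewrite mulr_ge0.
- by rewrite mulr_ge0// (le_trans f0).
- by rewrite ler_wpM2l.
Qed.

Lemma is_cvg_mgf s : s <= b + b -> cvgn (series (fun n => p n * expR (s * n%:R))).
Proof.
move=> sb; apply: (@cvg_series_expR_dominated _ 1) => n.
by rewrite mul1r expR_ge0 ler_expR ler_wpM2r.
Qed.

Let cube n : n%:R ^+ 3 <= 6 / b ^+ 3 * expR (b * n%:R) :> R.
Proof.
have bn : 0 <= b * n%:R by rewrite mulr_ge0// ltW.
rewrite mulrAC ler_pdivlMr ?exprn_gt0// mulrC -exprMn.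
exact: cube_le_expR.
Qed.

Lemma is_cvg_moment k : (0 < k <= 3)%N -> cvgn (series (fun n => p n * n%:R ^+ k)).
Proof.
move=> /andP[k0 k3]; apply: (@cvg_series_expR_dominated _ (6 / b ^+ 3)) => n.
rewrite exprn_ge0//=; apply: (le_trans (_ : _ <= n%:R ^+ 3)).
  by rewrite -!natrX ler_nat; case: n => [|n]; rewrite ?exp0n// leq_pexp2l.
apply: le_trans (cube n) _; rewrite ler_wpM2l ?divr_ge0 ?exprn_ge0 ?(ltW b0)//.
by rewrite ler_expR ler_wpM2r// lerDl ltW.
Qed.

Lemma mgf0 : mgf p 0 = 1.
Proof.
rewrite /mgf -(cvg_lim _ p1)//; congr (limn (series _)).
by apply/funext => n; rewrite mul0r expR0 mulr1.
Qed.

Lemma le_mgf s t : s <= t -> t <= b + b -> mgf p s <= mgf p t.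
Proof.
move=> st tb; apply: lim_series_le; [exact: is_cvg_mgf (le_trans st tb)|exact: is_cvg_mgf|].
by move=> n; rewrite ler_wpM2l// ler_expR ler_wpM2r.
Qed.

Lemma mgf_ge0 s : s <= b + b -> 0 <= mgf p s.
Proof.
move=> sb; apply: limr_ge; first exact: is_cvg_mgf.
by apply: nearW => n; apply: sumr_ge0 => i _; rewrite mulr_ge0 ?expR_ge0.
Qed.

(** One limit computation that serves the variance and both Taylor bounds of [mgf]. *)
Lemma cvg_series_deg2 (u v w : R) :
  series (fun n => p n * (u + v * n%:R + w * n%:R ^+ 2)) @ \oo -->
  u + v * moment p 1 + w * moment p 2.
Proof.
have c1 := is_cvg_moment (isT : (0 < 1 <= 3)%N).
have c2 := is_cvg_moment (isT : (0 < 2 <= 3)%N).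
rewrite (_ : series _ = fun N => u * series p N + v * series (fun n => p n * n%:R ^+ 1) N +
  w * series (fun n => p n * n%:R ^+ 2) N); last first.
  apply/funext => N; rewrite /series/= !big_distrr/= -!big_split/=.
  by apply: eq_bigr => n _; rewrite expr1; ring.
apply: cvgD; last exact: cvgMl_tmp.
apply: cvgD; last exact: cvgMl_tmp.
by rewrite -[X in _ --> X]mulr1; exact: cvgMl_tmp.
Qed.

Lemma cvg_series_variance :
  series (fun n => p n * (n%:R - moment p 1) ^+ 2) @ \oo --> moment p 2 - moment p 1 ^+ 2.
Proof.
set mu := moment p 1.
have := @cvg_series_deg2 (mu ^+ 2) (- (2 * mu)) 1; rewrite -/mu.
rewrite (_ : _ + _ = moment p 2 - mu ^+ 2); last by ring.
have -> // : (fun n : nat => p n * (mu ^+ 2 + - (2 * mu) * n%:R + 1 * n%:R ^+ 2)) =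
  (fun n : nat => p n * (n%:R - mu) ^+ 2) by apply/funext => n; ring.
Qed.

Lemma moment_sqr_le : moment p 1 ^+ 2 <= moment p 2.
Proof.
rewrite -subr_ge0 -(cvg_lim _ cvg_series_variance)//.
apply: limr_ge; first exact: cvgP cvg_series_variance.
by apply: nearW => n; apply: sumr_ge0 => i _; rewrite mulr_ge0// sqr_ge0.
Qed.

(** All the mass sits on [n >= 1]; this provides [mu > 0]. *)
Lemma moment1_ge1 : p 0%N = 0 -> 1 <= moment p 1.
Proof.
move=> p00; rewrite -[leLHS](cvg_lim _ p1)//; apply: lim_series_le.
- exact: cvgP p1.
- exact: is_cvg_moment.
- move=> [|n]; first by rewrite p00 mul0r.
  by rewrite expr1 ler_peMr// ler1n.
Qed.

Lemma mgf_ge_deg2 s : 0 <= s <= b ->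
  1 + moment p 1 * s + moment p 2 * s ^+ 2 / 2 <= mgf p s.
Proof.
move=> /andP[s0 sb].
have -> : 1 + moment p 1 * s + moment p 2 * s ^+ 2 / 2 =
  1 + s * moment p 1 + s ^+ 2 / 2 * moment p 2 by ring.
have h := @cvg_series_deg2 1 s (s ^+ 2 / 2).
rewrite -(cvg_lim _ h)//; apply: lim_series_le; first exact: cvgP h.
  by apply: is_cvg_mgf; rewrite (le_trans sb)// lerDl ltW.
move=> n; rewrite ler_wpM2l//; apply: le_trans (expR_ge_deg2 _); last by rewrite mulr_ge0.
by rewrite exprMn mulrAC.
Qed.

(** The remainder [(s n)^3 e^{sn}] is at most [s^3 (6 / b^3) e^{2bn}]: one factor [e^{bn}] pays for
    [n^3], the other for [e^{sn}]. Hence the exponential moment at [b + b] rather than at [b]. *)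
Lemma mgf_le_deg2 s : 0 <= s <= b ->
  mgf p s <= 1 + moment p 1 * s + moment p 2 * s ^+ 2 / 2
             + 6 / b ^+ 3 * mgf p (b + b) * s ^+ 3.
Proof.
move=> /andP[s0 sb].
rewrite [leRHS](_ : _ = 1 + s * moment p 1 + s ^+ 2 / 2 * moment p 2 +
  6 / b ^+ 3 * s ^+ 3 * mgf p (b + b)); last by ring.
have h := @cvg_series_deg2 1 s (s ^+ 2 / 2).
have g := is_cvg_mgf (lexx (b + b)).
rewrite -(cvg_lim _ h)//.
rewrite /(mgf p (b + b)) -[X in _ + X]/(_ *: _) -lim_seriesZ// -lim_seriesD//; last 2 first.
- exact: cvgP h.
- exact: is_cvg_seriesZ.
apply: lim_series_le.
- by apply: is_cvg_mgf; rewrite (le_trans sb)// lerDl ltW.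
- by apply: is_cvg_seriesD; [exact: cvgP h|exact: is_cvg_seriesZ].
move=> n.
have -> : ((fun n : nat => p n * (1 + s * n%:R + s ^+ 2 / 2 * n%:R ^+ 2)) +
    (6 / b ^+ 3 * s ^+ 3) *: (fun n : nat => p n * expR ((b + b) * n%:R))) n =
    p n * (1 + s * n%:R + s ^+ 2 / 2 * n%:R ^+ 2 +
           6 / b ^+ 3 * s ^+ 3 * expR ((b + b) * n%:R)).
  by rewrite mulrDr [X in _ = _ + X]mulrCA.
rewrite ler_wpM2l//.
apply: le_trans (expR_le_deg2 _) _; first by rewrite mulr_ge0.
rewrite exprMn [_ / 2]mulrAC lerD2l exprMn.
rewrite [leRHS](_ : _ = s ^+ 3 * (6 / b ^+ 3 * expR (b * n%:R) * expR (b * n%:R))).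
  by rewrite -[leLHS]mulrA ler_wpM2l ?exprn_ge0// ler_pM ?expR_ge0 ?exprn_ge0// ler_expR ler_wpM2r.
by rewrite [(b + b) * _]mulrDl expRD; ring.
Qed.
End light_tail.

(** * Decay rate of the Laplace transform and its expansion *)

Lemma near_right_scale (R : realType) (Q : R -> Prop) (k : R) : 0 < k ->
  (\forall a \near 0^'+, Q a) -> \forall t \near 0^'+, Q (t * k).
Proof.
move=> k0 [e /= e0 h]; near=> t.
have t0 : 0 < t by [].
apply: h => /=; last by rewrite mulr_gt0.
rewrite sub0r normrN gtr0_norm ?mulr_gt0// -ltr_pdivlMr//.
by near: t; apply: nbhs_right_lt; rewrite divr_gt0.
Unshelve. all: by end_near. Qed.

Section log_asymptotics.
Context (R : realType) (p : nat -> R) (b : R).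
Hypothesis p0 : forall n, 0 <= p n.
Hypothesis p00 : p 0%N = 0.
Hypothesis b0 : 0 < b.
Hypothesis p1 : series p @ \oo --> (1 : R).
Hypothesis pb : cvgn (series (fun n => p n * expR ((b + b) * n%:R))).

Let series_le (f : nat -> R) n : (forall k, 0 <= f k) -> cvgn (series f) ->
  series f n <= limn (series f).
Proof.
move=> f0 cf; apply: nondecreasing_cvgn_le => //.
by apply: nondecreasing_series => k _ _.
Qed.

Let lt2b s : s <= b -> s <= b + b.
Proof. by move=> sb; rewrite (le_trans sb)// lerDl ltW. Qed.

Let mgf_nd s t : 0 <= s -> s <= t -> t <= b -> mgf p s <= mgf p t.
Proof. by move=> _ st tb; apply: (le_mgf p0 pb) => //; exact: lt2b. Qed.

Let mu0 : 0 < moment p 1.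
Proof. by apply: lt_le_trans (moment1_ge1 p0 b0 p1 pb p00). Qed.

Let B0 : 0 <= 6 / b ^+ 3 * mgf p (b + b).
Proof. by rewrite mulr_ge0 ?divr_ge0 ?exprn_ge0 ?(ltW b0)// (mgf_ge0 p0 pb). Qed.

(** Exponents [s <= r < s'] within [q / 2] of the root [r] feed the two bounds on the renewal
    equation; the constants in front become additive under [ln] and vanish after division by [t]. *)
Lemma renewal_eq_log_cvg (u : nat -> R) (a th : R) (nt : R -> nat) :
  0 <= a -> expR a < 1 + moment p 1 * (b / 2) -> 0 < th ->
  (forall t, 0 < t -> t <= (nt t)%:R < t + 1) ->
  (forall n, (0 < n)%N -> u n = 1 - series p n +
     expR (- a) * \sum_(0 <= j < n) p j * u (n - j)%N) ->
  - (1 / (th * t)) * ln (u (nt t)) @[t --> +oo] --> mgf_root (mgf p) b a / th.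
Proof.
move=> a0 ab th0 ntP uE.
set r := mgf_root (mgf p) b a.
have m0 := mgf0 p1.
have rb : r <= b / 2.
  exact: (mgf_root_half b0 (moment_sqr_le p0 b0 p1 pb) m0 mgf_nd (mgf_ge_deg2 p0 b0 p1 pb)).
have r0 : 0 <= r.
  apply: (mgf_root_ge b0 m0) => //; first by rewrite lexx ltW.
  by rewrite m0 -[leLHS]expR0 ler_expR.
apply/cvgrPdist_le => e e0.
set q := e * th; have q0 : 0 < q by rewrite mulr_gt0.
(* Clipped at 0, where [mgf] is 1, because the upper bound requires a nonnegative exponent. *)
pose s := Num.max 0 (r - q / 2).
have s0 : 0 <= s by rewrite le_max lexx.
have sr : r - q / 2 <= s by rewrite le_max lexx orbT.
have sphi : mgf p s <= expR a.
  rewrite /s; case: (leP 0 (r - q / 2)) => h; last by rewrite m0 -[leLHS]expR0 ler_expR.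
  apply: (mgf_le_below_root b0 m0 mgf_nd) => //.
  by rewrite -/r ltrBlDr ltrDl divr_gt0.
(* The cap [b / 2] keeps [s'] within [b], because [r <= b / 2]. *)
pose s' := r + Num.min (q / 2) (b / 2).
have b20 : 0 < b / 2 by rewrite divr_gt0.
have q20 : 0 < q / 2 by rewrite divr_gt0.
have rs' : r < s' by rewrite /s' ltrDl lt_min q20.
have s'b : s' <= b.
  have : Num.min (q / 2) (b / 2) <= b / 2 by rewrite ge_min lexx orbT.
  rewrite /s'; lra.
have s'q : s' <= r + q / 2 by rewrite lerD2l ge_min lexx.
have s'phi : expR a < mgf p s'.
  exact: (mgf_gt_above_root b0 m0).
have sb : s <= b.
  by rewrite /s ge_max (ltW b0)/=; lra.
have mgf_part x n : x <= b -> series (fun j => p j * expR (x * j%:R)) n <= mgf p x.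
  move=> xb; apply: series_le; last exact: (is_cvg_mgf p0 pb (lt2b xb)).
  by move=> k; rewrite mulr_ge0// expR_ge0.
(* Strictness of [e^a < mgf p s'] lets a finite partial sum reach [e^a]. *)
have [K s'K] : exists K, expR a <= series (fun j => p j * expR (s' * j%:R)) K.
  have c : cvgn (series (fun j => p j * expR (s' * j%:R))).
    exact: (is_cvg_mgf p0 pb (lt2b s'b)).
  have /cvgrPdist_lt/(_ (mgf p s' - expR a)) := c.
  rewrite subr_gt0 => /(_ s'phi) [K _ /(_ K (leqnn K))/= h].
  exists K; have := ler_norm (mgf p s' - series (fun j => p j * expR (s' * j%:R)) K).
  by rewrite -/(mgf p s') in h; lra.
near=> t.
have t0 : 0 < t by [].
(* For large [t] the constants [a] and [a K] are negligible; the extra [s'] in [tK] pays for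
   rounding [t] up to [nt t < t + 1]. *)
have ta : a <= q / 2 * t.
  rewrite [leRHS]mulrC -ler_pdivrMr//; near: t; apply: nbhs_pinfty_ge; exact: num_real.
have tK : s' + a * K%:R <= q / 2 * t.
  rewrite [leRHS]mulrC -ler_pdivrMr//; near: t; apply: nbhs_pinfty_ge; exact: num_real.
have /andP[tn nt1] := ntP t t0.
have n0 : (0 < nt t)%N by rewrite -(ltr_nat R) (lt_le_trans t0).
have up := renewal_eq_le p0 p00 p1 s0 uE (fun n => le_trans (mgf_part s n sb) sphi) n0.
have pp1 n : series p n <= 1.
  rewrite -(cvg_lim _ p1)//; apply: series_le => //; exact: cvgP p1.
have s'0 : 0 <= s' by rewrite (le_trans r0)// ltW.
have lo := renewal_eq_ge p0 p00 pp1 a0 s'0 uE s'K n0.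
set n := nt t in tn nt1 n0 up lo *.
have un0 : 0 < u n by apply: lt_le_trans lo; rewrite mulr_gt0 ?expR_gt0.
have lup : ln (u n) <= a - s * n%:R.
  by rewrite -[leRHS]expRK ler_ln ?posrE ?expR_gt0// expRD.
have llo : - (a * K%:R) - s' * n%:R <= ln (u n).
  by rewrite -[leLHS]expRK ler_ln ?posrE ?expR_gt0// expRD.
have -> : r / th - - (1 / (th * t)) * ln (u n) = (r * t + ln (u n)) / (th * t).
  by field; rewrite !gt_eqF.
have tht0 : 0 < th * t by rewrite mulr_gt0.
rewrite normf_div (gtr0_norm tht0) ler_pdivrMr// mulrA -/q.
have sn : s * t <= s * n%:R by rewrite ler_wpM2l.
have rst : (r - q / 2) * t <= s * t by rewrite ler_wpM2r// ltW.
have sn' : s' * n%:R <= s' * (t + 1) by rewrite ler_wpM2l// ltW.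
have rst' : s' * t <= (r + q / 2) * t by rewrite ler_wpM2r// ltW.
rewrite ler_norml; apply/andP; split; lra.
Unshelve. all: by end_near. Qed.

(** The root expansion is applied at [a = th k] with tolerance [e / k^2], so that its error is
    exactly [e th^2]. *)
Lemma mgf_root_scaled_cvg (k : R) : 0 < k ->
  let mu := moment p 1 in
  (mgf_root (mgf p) b (th * k) / th -
    (k / mu - k ^+ 2 * (moment p 2 - mu ^+ 2) / (2 * mu ^+ 3) * th)) / th
    @[th --> 0^'+] --> (0 : R).
Proof.
move=> k0 mu; apply/cvgrPdist_le => e e0.
have ek0 : 0 < e / k ^+ 2 by rewrite divr_gt0// exprn_gt0.
have := mgf_root_expansion b0 mu0 (moment_sqr_le p0 b0 p1 pb) B0 (mgf0 p1) mgf_nd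
  (mgf_ge_deg2 p0 b0 p1 pb) (mgf_le_deg2 p0 b0 p1 pb) ek0.
move/(near_right_scale k0) => h; near=> th.
have th0 : 0 < th by [].
have : `|mgf_root (mgf p) b (th * k) -
   (th * k / mu - (moment p 2 - mu ^+ 2) / (2 * mu ^+ 3) * (th * k) ^+ 2)| <=
   e / k ^+ 2 * (th * k) ^+ 2 by near: th.
set r := mgf_root _ _ _; set m2 := moment p 2.
have mun0 : mu != 0 by rewrite gt_eqF.
have thn0 : th != 0 by rewrite gt_eqF.
have -> : e / k ^+ 2 * (th * k) ^+ 2 = e * th ^+ 2.
  by field; rewrite gt_eqF.
rewrite sub0r normrN.
have -> : (r / th - (k / mu - k ^+ 2 * (m2 - mu ^+ 2) / (2 * mu ^+ 3) * th)) / th =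
  (r - (th * k / mu - (m2 - mu ^+ 2) / (2 * mu ^+ 3) * (th * k) ^+ 2)) / th ^+ 2.
  by field; rewrite thn0 mun0.
have th2 : 0 < th ^+ 2 by rewrite exprn_gt0.
by rewrite normf_div (gtr0_norm th2) ler_pdivrMr.
Unshelve. all: by end_near. Qed.
End log_asymptotics.

(** * Partial sums of independent integer variables *)

(** [P(T_1 + ... + T_k < n)] for independent [T_i] with mass function [p]. *)
Fixpoint partial_sum_cdf {R : realType} (p : nat -> R) (k n : nat) : R :=
  if k is k'.+1 then \sum_(0 <= j < n) p j * partial_sum_cdf p k' (n - j)
  else (0 < n)%N%:R.

(** When [p 0 = 0] every summand is at least 1, so [k >= n] of them cannot total less than [n]. *)
Lemma partial_sum_cdf_eq0 (R : realType) (p : nat -> R) (k n : nat) :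
  p 0%N = 0 -> (n <= k)%N -> partial_sum_cdf p k n = 0.
Proof.
move=> p00; elim: k n => [|k IH] n nk /=; first by move: nk; rewrite leqn0 => /eqP ->.
rewrite big_nat big1// => -[|j] /= jn; first by rewrite p00 mul0r.
by rewrite IH ?mulr0// leq_subLR (leq_trans nk)// addSn ltnS leq_addl.
Qed.

Lemma partial_sum_cdf1 (R : realType) (p : nat -> R) (n : nat) :
  partial_sum_cdf p 1 n = series p n.
Proof.
by rewrite /= /series/= !big_nat; apply: eq_bigr => j /= jn; rewrite subn_gt0 jn mulr1n mulr1.
Qed.

(** The Laplace transform [E e^{-a N_n}], with [P(N_n = k)] written as
    [P(S_k < n) - P(S_{k+1} < n)]. *)
Definition count_laplace {R : realType} (p : nat -> R) (a : R) (n : nat) : R :=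
  \sum_(0 <= k < n) expR (- (a * k%:R)) * (partial_sum_cdf p k n - partial_sum_cdf p k.+1 n).

(** Conditioning on one summand: the term [k = 0] is [P(T >= n)], and in the others the recursion of
    [partial_sum_cdf] pulls out a summand [j] and lowers the count by one, which costs the factor
    [e^{-a}]. *)
Lemma count_laplace_eq (R : realType) (p : nat -> R) (a : R) (n : nat) :
  p 0%N = 0 -> (0 < n)%N -> count_laplace p a n = 1 - series p n +
    expR (- a) * \sum_(0 <= j < n) p j * count_laplace p a (n - j)%N.
Proof.
move=> p00; case: n => // n _; rewrite /count_laplace big_nat_recl//.
rewrite mulr0 oppr0 expR0 mul1r partial_sum_cdf1 /=; congr (_ + _).
under eq_bigr => k _.
  rewrite -[(\sum_(0 <= j < n.+1) p j * \sum_(0 <= _ < _) _)]/(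
    \sum_(0 <= j < n.+1) p j * partial_sum_cdf p k.+1 (n.+1 - j)).
  rewrite -sumrB mulr_sumr; over.
rewrite exchange_big/= big_distrr/=; apply: eq_big_nat => -[|j] /= jn.
  by rewrite p00 mul0r mulr0 big1// => k _; rewrite !mul0r subrr mulr0.
rewrite subSS.
(* The inner sum is extended from [n - j] to [n] terms; the added ones vanish because [k >= n - j]
   leaves no room for [k] summands. *)
rewrite [in RHS](big_nat_widen _ _ n) ?leq_subr//=.
rewrite !big_distrr/= [RHS]big_mkcond/= !big_nat; apply: eq_bigr => k /= kn.
case: ifPn => [_|].
  have -> : expR (- (a * k.+1%:R)) = expR (- a) * expR (- (a * k%:R)).
    by rewrite -expRD -natr1; congr expR; ring.
  by rewrite -[\sum_(_ <= _ < _) _]/(partial_sum_cdf p k.+1 (n - j)); ring.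
rewrite -leqNgt => h; rewrite -[\sum_(_ <= _ < _) _]/(partial_sum_cdf p k.+1 (n - j)).
by rewrite !partial_sum_cdf_eq0// ?mulr0 ?subrr ?mulr0// ltnW.
Qed.

Lemma measurable_preimage_nat (d : measure_display) (Om : measurableType d)
  (X : Om -> nat) : (forall n, measurable (X @^-1` [set n])) ->
  forall A, measurable (X @^-1` A).
Proof.
move=> mX A; rewrite (_ : _ @^-1` _ = \bigcup_(n in A) X @^-1` [set n]).
  by apply: bigcup_measurable => n _.
by apply/seteqP; split => [w Aw|w [n An /= ->]//]; exists (X w).
Qed.

Section partial_sums.
Context (d : measure_display) (Om : measurableType d) (R : realType).
Context (P : probability Om R) (X : nat -> Om -> nat) (p : nat -> R).
Hypothesis mX : forall l n, measurable (X l @^-1` [set n]).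
Hypothesis iX : mutually_independent_nat P X.
Hypothesis pX : forall l n, P (X l @^-1` [set n]) = (p n)%:E.

Let S k n := [set w | (\sum_(l < k) X l w < n)%N].

Let S0 n : S 0 n = if (0 < n)%N then setT else set0.
Proof.
by case: ifPn => n0; apply/seteqP; split => w //=; rewrite /S/= big_ord0 ?n0// (negbTE n0).
Qed.

Let S_split k n : S k.+1 n = \bigcup_(j in `I_n) (S k (n - j) `&` X k @^-1` [set j]).
Proof.
apply/seteqP; split => [w|w [j /= jn [/= h e]]]; rewrite /S/= big_ord_recr/=.
  move=> h; exists (X k w) => /=; first by rewrite (leq_ltn_trans _ h)// leq_addl.
  by split => //=; rewrite ltn_subRL addnC.
by rewrite e addnC -ltn_subRL.
Qed.

Lemma measurable_partial_sum_lt k n : measurable [set w | (\sum_(l < k) X l w < n)%N].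
Proof.
elim: k n => [|k IH] n.
  by rewrite -/(S 0 n) S0; case: ifP => _; [exact: measurableT|exact: measurable0].
rewrite -/(S k.+1 n) S_split; apply: bigcup_measurable => j _.
by apply: measurableI => //; exact: IH.
Qed.

(** The events on indices from [k] on make the induction work: splitting on the value of the last
    summand [X k] adds the event [X k = j] to them. *)
Lemma partial_sum_lt_indep k n (I : seq nat) (A : nat -> set nat) : uniq I ->
  (forall i, i \in I -> (k <= i)%N) ->
  P ([set w | (\sum_(l < k) X l w < n)%N] `&` \bigcap_(i in [set` I]) (X i @^-1` A i)) =
  ((partial_sum_cdf p k n)%:E * \prod_(i <- I) P (X i @^-1` A i))%E.
Proof.
elim: k n I A => [|k IH] n I A uI kI.
  rewrite -/(S 0 n) S0.
  case: ifPn => n0 /=; first by rewrite n0 setTI iX// mul1e.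
  by rewrite (negbTE n0) set0I measure0 mul0e.
rewrite -/(S k.+1 n) S_split setI_bigcupl.
have mE : measurable (\bigcap_(i in [set` I]) (X i @^-1` A i)).
  by apply: bigcap_measurableType => i _; exact: measurable_preimage_nat.
rewrite bigcup_mkord (@measure_semi_additive_ord_I _ _ _ _ (fun i => S k (n - i) `&`
  X k @^-1` [set i] `&` \bigcap_(i in [set` I]) X i @^-1` A i)); last 3 first.
- move=> j _; apply: measurableI => //; apply: measurableI => //.
  exact: measurable_partial_sum_lt.
- apply/trivIsetP => i j _ _ ij; rewrite -subset0 => w [[[_ /= +] _] [[_ /= +] _]].
  by move=> -> /eqP; rewrite (negbTE ij).
- apply: bigsetU_measurable => j _.
  apply: measurableI => //; apply: measurableI => //.
  exact: measurable_partial_sum_lt.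
have kNI : k \notin I by apply/negP => /kI; rewrite ltnn.
have step j : P (S k (n - j) `&` X k @^-1` [set j] `&`
      \bigcap_(i in [set` I]) X i @^-1` A i) =
    ((p j * partial_sum_cdf p k (n - j))%:E * \prod_(i <- I) P (X i @^-1` A i))%E.
  (* The event [X k = j] enters by prepending [k] to [I] and overriding [A] at [k]. *)
  have := IH (n - j)%N (k :: I) (fun i => if i == k then [set j] else A i).
  rewrite /= kNI uI => /(_ isT); rewrite big_cons eqxx pX.
  have -> : (\prod_(i <- I) P (X i @^-1` (if i == k then [set j] else A i)) =
             \prod_(i <- I) P (X i @^-1` A i))%E.
    apply: eq_big_seq => i iI; case: eqP => // ik.
    by move: kNI; rewrite -ik iI.
  rewrite mulrC EFinM -muleA => <-; last first.
    by move=> i; rewrite inE => /predU1P[->//|/kI/ltnW].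
  congr (P _); rewrite -setIA; congr (_ `&` _).
  have kI' i : i \in I -> (i == k) = false.
    by move=> iI; apply/eqP => ik; move: kNI; rewrite -ik iI.
  apply/seteqP; split => [w [kj h] i /=|w h].
    by rewrite inE => /predU1P[->|iI]; [rewrite eqxx|rewrite kI'//; exact: h].
  split; first by have := h k; rewrite /= inE eqxx; exact.
  by move=> i /= iI; have := h i; rewrite /= inE iI orbT kI'//; exact.
rewrite (eq_bigr (fun j : 'I_n => (p j * partial_sum_cdf p k (n - j))%:E *
  \prod_(i <- I) P (X i @^-1` A i))%E); last by move=> j _; exact: step.
have : (\prod_(i <- I) P (X i @^-1` A i))%E \is a fin_num.
  elim/big_ind : _ => // [x y|i _]; [exact: fin_numM|].
  by apply: fin_num_measure; exact: measurable_preimage_nat.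
move: (\prod_(i <- I) _)%E => c /fineK <-.
rewrite -EFinM [partial_sum_cdf _ _ _]/= big_mkord mulr_suml -sumEFin.
by apply: eq_bigr => j _; rewrite EFinM.
Qed.

Lemma partial_sum_lt_prob k n :
  P [set w | (\sum_(l < k) X l w < n)%N] = (partial_sum_cdf p k n)%:E.
Proof.
have := @partial_sum_lt_indep k n [::] (fun=> setT).
by rewrite set_nil bigcap_set0 setIT big_nil mule1; exact.
Qed.
End partial_sums.

(** * Expectations of functions of an integer-valued variable *)

Section expectation_nat.
Context (d : measure_display) (Om : measurableType d) (R : realType).
Context (P : probability Om R) (X : Om -> nat) (p : nat -> R).
Hypothesis mX : forall n, measurable (X @^-1` [set n]).
Hypothesis pX : forall n, P (X @^-1` [set n]) = (p n)%:E.

Lemma expectation_nat (f : nat -> R) (l : R) : (forall n, 0 <= f n) ->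
  series (fun n => p n * f n) @ \oo --> l ->
  ('E_P[fun w => f (X w)] = l%:E)%E.
Proof.
move=> f0 fl; rewrite unlock.
have XT : \bigcup_k (X @^-1` [set k]) = setT.
  by apply/seteqP; split => // w _; exists (X w).
rewrite -XT ge0_integral_bigcup//; last 3 first.
- rewrite XT => _ Y mY; rewrite setTI.
  exact: (measurable_preimage_nat mX ((EFin \o f) @^-1` Y)).
- by move=> w _; rewrite lee_fin.
- by apply/trivIsetP => i j _ _ ij; rewrite -subset0 => w [/= -> /eqP]; rewrite (negbTE ij).
have Ei i : (\int[P]_(w in X @^-1` [set i]) (f (X w))%:E = (p i * f i)%:E)%E.
  rewrite (eq_integral (cst (f i)%:E)); last by move=> w; rewrite inE /= => ->.
  by rewrite integral_cst//= pX -EFinM mulrC.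
apply/cvg_lim => //.
rewrite (_ : (fun n => _) = EFin \o series (fun n => p n * f n)).
  exact: cvg_comp fl _.
by apply/funext => n /=; rewrite /series/= -sumEFin; apply: eq_bigr => i _; exact: Ei.
Qed.

Lemma cvg_series_mass : series p @ \oo --> (1 : R).
Proof.
have XT : \bigcup_k (X @^-1` [set k]) = setT.
  by apply/seteqP; split => // w _; exists (X w).
have tX : trivIset setT (fun k => X @^-1` [set k]).
  by apply/trivIsetP => i j _ _ ij; rewrite -subset0 => w [/= -> /eqP]; rewrite (negbTE ij).
have h : (fun n => \sum_(0 <= i < n) P (X @^-1` [set i]))%E @ \oo -->
    P (\bigcup_k (X @^-1` [set k])) by exact: measure_sigma_additive.
move: h; rewrite XT probability_setT.
rewrite (_ : (fun n => _) = EFin \o series p).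
  by move/fine_cvg.
by apply/funext => n /=; rewrite /series/= -sumEFin; apply: eq_bigr => i _; exact: pX.
Qed.
End expectation_nat.

(** * Law of the renewal counting process *)

Section renewal.
Context (R : realType) (T : nat -> nat) (t : R) (n : nat).
Hypothesis t0 : 0 < t.
Hypothesis tn : t <= n%:R < t + 1.

Let S k := (\sum_(l < k) T l)%N.

(** Partial sums are integers, so the real time [t] can be replaced by its ceiling [n]. *)
Lemma natr_lt_ceil m : (m%:R < t) = (m < n)%N.
Proof.
move: tn => /andP[tn1 nt]; apply/idP/idP => [mt|].
  by rewrite -(ltr_nat R) (lt_le_trans mt).
rewrite -(ler_nat R) -natr1; lra.
Qed.

Let S_nd j k : (j <= k)%N -> (S j <= S k)%N.
Proof.
by move=> /subnKC <-; rewrite /S big_split_ord/= leq_addr.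
Qed.

(** The last alternative is the default value 0 of [renewal_count]: by monotonicity, the maximum
    fails to exist only if all partial sums stay below [n]. *)
Lemma renewal_countP k : renewal_count T t = k <->
  ((\sum_(l < k) T l < n)%N /\ ~~ (\sum_(l < k.+1) T l < n)%N) \/
  (k = 0%N /\ forall j, (\sum_(l < j) T l < n)%N).
Proof.
have maxP m : (S m)%:R < t /\ (forall j, (S j)%:R < t -> (j <= m)%N) <->
    (S m < n)%N /\ ~~ (S m.+1 < n)%N.
  rewrite natr_lt_ceil; split => -[mn h]; split => //.
    by apply/negP => h'; have := h m.+1; rewrite natr_lt_ceil h' ltnn => /(_ isT).
  move=> j; rewrite natr_lt_ceil [(j <= m)%N]leqNgt => jn; apply/negP => mj.
  by move/negP: h; apply; apply: leq_ltn_trans jn; exact: S_nd.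
rewrite /renewal_count; case: pselect => [h|h].
  case: cid => m /= hm; have /maxP[m1 m2] := hm.
  split => [<-|[[k1 k2]|[_ /(_ m.+1)]]]; [by left| |by rewrite (negbTE m2)].
  have [_ hk] : (S k)%:R < t /\ (forall j, (S j)%:R < t -> (j <= k)%N) by apply/maxP.
  apply/eqP; rewrite eqn_leq; apply/andP; split; [|apply: (proj2 hm)].
    by apply: hk; rewrite natr_lt_ceil.
  by rewrite natr_lt_ceil.
split => [<-|[/maxP hk|[-> //]]]; last by exfalso; apply: h; exists k.
right; split => // j; elim: j => [|j IH].
  by rewrite -natr_lt_ceil big_ord0.
by apply: contrapT => /negP hj; apply: h; exists j; apply/maxP.
Qed.
End renewal.

Section renewal_prob.
Context (d : measure_display) (Om : measurableType d) (R : realType).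
Context (P : probability Om R) (X : nat -> Om -> nat) (p : nat -> R).
Hypothesis mX : forall l n, measurable (X l @^-1` [set n]).
Hypothesis iX : mutually_independent_nat P X.
Hypothesis pX : forall l n, P (X l @^-1` [set n]) = (p n)%:E.
Hypothesis p00 : p 0%N = 0.
Context (t : R) (n : nat).
Hypothesis t0 : 0 < t.
Hypothesis tn : t <= n%:R < t + 1.

Let S k := [set w | (\sum_(l < k) X l w < n)%N].
Let N w := renewal_count (fun l => X l w) t.
(* [renewal_count] takes its junk value [0] on [Z 0], a null set. *)
Let Z k : set Om := if k is 0%N then \bigcap_j S j else set0.

Let mS k : measurable (S k).
Proof. exact: measurable_partial_sum_lt. Qed.

Let mZ k : measurable (Z k).
Proof.
by case: k => [|k]; [apply: bigcap_measurableType|exact: measurable0].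
Qed.

Let Z0 k : P (Z k) = 0%E.
Proof.
case: k => [|k]; last exact: measure0.
(* Since [p 0 = 0], [n] durations almost surely total at least [n]. *)
have PS : P (S n) = 0%E by rewrite (partial_sum_lt_prob mX iX pX) partial_sum_cdf_eq0.
by apply: (subset_measure0 (mZ 0%N) (mS n) _ PS) => w; exact.
Qed.

Let NE k : N @^-1` [set k] = (S k `\` S k.+1) `|` Z k.
Proof.
apply/seteqP; split => [w /= /(renewal_countP _ t0 tn)|w h].
  by move=> [[h1 /negP h2]|[-> h]]; [left|right => j _; exact: h].
apply/(renewal_countP _ t0 tn); case: h => [[h1 h2]|]; first by left; split => //; apply/negP.
by case: k => [|k]//= h; right; split => // j; exact: h.
Qed.

Lemma measurable_renewal_count k :
  measurable ((fun w => renewal_count (fun l => X l w) t) @^-1` [set k]).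
Proof. by rewrite -/N NE; apply: measurableU => //; exact: measurableD. Qed.

Lemma renewal_count_prob k :
  P ((fun w => renewal_count (fun l => X l w) t) @^-1` [set k]) =
  (partial_sum_cdf p k n - partial_sum_cdf p k.+1 n)%:E.
Proof.
rewrite -/N NE (measureU0 (measurableD (mS k) (mS k.+1)) (mZ k) (Z0 k)).
rewrite measureD//; last by rewrite ltey_eq fin_num_measure.
rewrite setIidr; last first.
  by move=> w; rewrite /S/= big_ord_recr/=; apply: leq_ltn_trans; rewrite leq_addr.
by rewrite EFinB; congr (_ - _)%E; exact: partial_sum_lt_prob.
Qed.

Lemma expectation_expR_renewal_count (a : R) :
  ('E_P[fun w => expR (- a * (renewal_count (fun l => X l w) t)%:R)] =
  (count_laplace p a n)%:E)%E.
Proof.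
have := expectation_nat measurable_renewal_count renewal_count_prob
  (f := fun k => expR (- a * k%:R)).
apply; first by move=> k; exact: expR_ge0.
(* The series is eventually constant: the masses vanish from [k = n] on. *)
apply: cvg_near_cst; near=> m.
have nm : (n <= m)%N by near: m; exists n.
rewrite /series /count_laplace/= (@big_cat_nat _ _ _ n 0)//=.
rewrite [X in _ + X]big_nat [X in _ + X]big1 ?addr0.
  by apply: eq_bigr => k _; rewrite mulNr mulrC.
move=> k /andP[nk _]; rewrite -/(partial_sum_cdf p k.+1 n).
by rewrite !partial_sum_cdf_eq0// ?subrr ?mul0r// ltnW.
Unshelve. all: by end_near. Qed.
End renewal_prob.

(** * Tail of the HARQ transmission time *)

Section harq_time.
Context (R : realType) (Rate SNR : R) (z : nat -> R).
Hypothesis SNR0 : 0 < SNR.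
Hypothesis Rate0 : 0 < Rate.
Hypothesis z0 : forall i, 0 <= z i.

Lemma log2_ge0 (x : R) : 0 <= x -> 0 <= log2 (1 + SNR * x).
Proof.
by move=> x0; rewrite /log2 divr_ge0// ln_ge0 ?ler1n// lerDl mulr_ge0// ltW.
Qed.

Lemma le_acc_info m n : (m <= n)%N -> acc_info SNR z m <= acc_info SNR z n.
Proof.
move=> /subnKC <-; rewrite /acc_info big_split_ord/= lerDl.
by apply: sumr_ge0 => i _; exact: log2_ge0.
Qed.

(** Accumulated information is nondecreasing, so minimality needs checking only at the preceding
    block. The value 0 is the default taken when [Rate] is never exceeded. *)
Lemma harq_timeP n : harq_time Rate SNR z = n <->
  if n is m.+1 then ~~ (Rate < acc_info SNR z m) /\ Rate < acc_info SNR z m.+1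
  else forall m, ~~ (Rate < acc_info SNR z m).
Proof.
have acc0 : ~~ (Rate < acc_info SNR z 0) by rewrite /acc_info big_ord0 ltNge ltW.
rewrite /harq_time; case: pselect => [h|h].
  case: ex_minnP => M /andP[M1 M2] Mmin; case: n => [|n].
    split; last by move=> /(_ M); rewrite M2.
    by move=> M0; rewrite M0 in M1.
  split => [MS|[n1 n2]].
    subst M; split => //; apply/negP => hn.
    case: n M1 M2 Mmin hn => [|n] _ _ Mmin hn; first by move: acc0; rewrite hn.
    by have := Mmin n.+1; rewrite hn ltnn => /(_ isT).
  apply/eqP; rewrite eqn_leq Mmin//=.
  rewrite ltnNge; apply/negP => Mn; move/negP: n1; apply.
  exact: lt_le_trans M2 (le_acc_info Mn).
case: n => [|n]; split => //.
  move=> _ m; apply/negP => hm; apply: h; exists m; split => //.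
  by case: m hm => // hm; move: acc0; rewrite hm.
by move=> [_ hn]; exfalso; apply: h; exists n.+1.
Qed.
End harq_time.

(* Chernoff's bound at base 2: [1 - q / 2] is [E 2^{-X}] for a Bernoulli variable [X]. *)
Lemma partial_sum_cdf_bernoulli_le (R : realType) (q : R) (k n : nat) : 0 <= q <= 1 ->
  partial_sum_cdf (fun j => if j is 0%N then 1 - q else if j is 1%N then q else 0) k n <=
  2 ^+ n * (1 - q / 2) ^+ k.
Proof.
move=> /andP[q0 q1]; set p := fun j => _.
have r0 : 0 <= 1 - q / 2 by lra.
elim: k n => [|k IH] n /=.
  rewrite expr0 mulr1; apply: (le_trans (_ : _ <= 1)); first by case: (0 < n)%N.
  by rewrite exprn_ege1// ler1n.
case: n => [|n].
  by rewrite big_geq// mul1r exprn_ge0.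
rewrite big_nat_recl//= subn0.
have h0 : (1 - q) * partial_sum_cdf p k n.+1 <= (1 - q) * (2 ^+ n.+1 * (1 - q / 2) ^+ k).
  by rewrite ler_wpM2l// subr_ge0.
have h1 : \sum_(0 <= i < n) p i.+1 * partial_sum_cdf p k (n.+1 - i.+1) <=
    q * (2 ^+ n * (1 - q / 2) ^+ k).
  case: n {h0} => [|n].
    by rewrite big_geq// mulr_ge0// mulr_ge0 ?exprn_ge0.
  rewrite big_nat_recl//= big1 ?addr0; last by move=> i _; rewrite mul0r.
  by rewrite ler_wpM2l// subSS subn0.
apply: le_trans (lerD h0 h1) _.
by rewrite !exprS le_eqVlt; apply/orP; left; apply/eqP; field.
Qed.

Section harq_tail.
Context (d : measure_display) (Om : measurableType d) (R : realType).
Context (P : probability Om R) (SNR Rate : R) (z : nat -> Om -> R).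
Hypothesis SNR0 : 0 < SNR.
Hypothesis Rate0 : 0 < Rate.
Hypothesis mz : forall i, measurable_fun setT (z i).
Hypothesis z0 : forall i w, 0 <= z i w.
Hypothesis iz : mutually_independent_R P z.
Hypothesis ez : forall i (A : set R), measurable A -> P (z i @^-1` A) = P (z 0%N @^-1` A).
Hypothesis pz : (0 < P [set w | (0 < z 0%N w)%R])%E.

Lemma measurable_acc_info_gt n : measurable [set w | Rate < acc_info SNR (fun i => z i w) n].
Proof.
have mf : measurable_fun setT (fun w => acc_info SNR (fun i => z i w) n).
  apply: measurable_sum => i; apply: measurable_funM => //.
  apply: measurableT_comp; first exact: measurable_ln.
  by apply: measurable_funD => //; exact: measurable_funM.
have := mf measurableT `]Rate, +oo[%classic (measurable_itv _).
rewrite setTI; congr measurable; apply/seteqP.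
by split => w /=; rewrite in_itv/= andbT.
Qed.

(** [{z > 0}] is the union of the events [{z > 1 / (n + 1)}], which cannot all be null. *)
Lemma exists_positive_threshold :
  exists2 e : R, 0 < e & (0 < P [set w | (e < z 0%N w)%R])%E.
Proof.
have m (e : R) : measurable [set w | e < z 0%N w].
  have := @mz 0%N measurableT `]e, +oo[%classic (measurable_itv _).
  rewrite setTI; congr measurable; apply/seteqP.
  by split => w /=; rewrite in_itv/= andbT.
apply: contrapT => h; move: pz; apply/negP; rewrite -leNgt.
have -> : [set w | 0 < z 0%N w] = \bigcup_n [set w | n.+1%:R^-1 < z 0%N w].
  apply/seteqP; split => [w /= w0|w [n _ /=]]; last exact: le_lt_trans.
  exists (Num.trunc (z 0%N w)^-1) => //=.
  by rewrite invf_plt ?posrE// truncnS_gt.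
rewrite le_eqVlt; apply/orP; left; apply/eqP.
have F0 n : P [set w | n.+1%:R^-1 < z 0%N w] = 0%E.
  apply/eqP; rewrite eq_le measure_ge0 andbT leNgt; apply/negP => h0.
  by apply: h; exists n.+1%:R^-1; rewrite ?invr_gt0.
apply/eqP; rewrite eq_le measure_ge0 andbT.
apply: le_trans (generalized_Boole_inequality _ _ _) _ => //.
  exact: bigcup_measurable.
by rewrite eseries0 // => n _ _; exact: F0.
Qed.

(** A block with [z i > e] carries at least [c] bits, so too little information after [n] blocks
    forces fewer than [K] such blocks, and their number is a sum of independent Bernoulli
    variables. *)
Lemma acc_info_le_tail : exists C r : R, [/\ 0 <= C, 0 < r, r < 1 &
  forall n, (P (~` [set w | (Rate < acc_info SNR (fun i => z i w) n)%R]) <= (C * r ^+ n)%:E)%E].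
Proof.
have [e e0 Pe] := exists_positive_threshold.
pose X i w := nat_of_bool (e < z i w).
have zpre i : z i @^-1` `]e, +oo[ = [set w | e < z i w].
  by apply/seteqP; split => w /=; rewrite in_itv/= andbT.
have mgt i : measurable [set w | e < z i w].
  by have := @mz i measurableT `]e, +oo[%classic (measurable_itv _); rewrite setTI zpre.
pose q := fine (P [set w | e < z 0%N w]).
have Pq i : P [set w | e < z i w] = q%:E.
  have := ez i (measurable_itv `]e, +oo[).
  by rewrite !zpre => ->; rewrite fineK// fin_num_measure.
pose p j : R := if j is 0%N then 1 - q else if j is 1%N then q else 0.
have XE1 i : X i @^-1` [set 1%N] = [set w | e < z i w].
  by apply/seteqP; split => w; rewrite /X /=; case: (e < z i w).
have XE0 i : X i @^-1` [set 0%N] = ~` [set w | e < z i w].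
  by apply/seteqP; split => w; rewrite /X /=; case: (e < z i w).
have XE2 i n : X i @^-1` [set n.+2] = set0.
  by apply/seteqP; split => w; rewrite /X /=; case: (e < z i w).
have mX i n : measurable (X i @^-1` [set n]).
  case: n => [|[|n]]; rewrite ?XE0 ?XE1 ?XE2//; exact: measurableC.
have pX i n : P (X i @^-1` [set n]) = (p n)%:E.
  case: n => [|[|n]]; rewrite ?XE0 ?XE1 ?XE2 ?measure0//.
  by rewrite probability_setC// Pq.
have iX : mutually_independent_nat P X.
  move=> I A uI.
  have mA i : measurable [set x : R | A i (nat_of_bool (e < x))].
    apply: (@measurable_preimage_nat _ _ (fun x : R => nat_of_bool (e < x))).
    case => [|[|n]].
    - rewrite (_ : _ @^-1` _ = `]-oo, e]%classic)//.
      by apply/seteqP; split => x /=; rewrite in_itv/= leNgt; case: (e < x).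
    - rewrite (_ : _ @^-1` _ = `]e, +oo[%classic)//.
      by apply/seteqP; split => x /=; rewrite in_itv/= andbT; case: (e < x).
    - rewrite (_ : _ @^-1` _ = set0)//.
      by apply/seteqP; split => x //=; case: (e < x).
  exact: (iz uI mA).
have q0 : 0 < q by rewrite -lte_fin -(Pq 0%N).
have q1 : q <= 1 by rewrite -lee_fin -(Pq 0%N) probability_le1.
pose c := log2 (1 + SNR * e).
have c0 : 0 < c.
  by rewrite /c /log2 divr_gt0// ln_gt0// ?ltr1n// ltrDl mulr_gt0.
(* Chosen so that [K] blocks of [c] bits exceed [Rate]. *)
pose K := (Num.trunc (Rate / c)).+1.
have Kc : Rate < c * K%:R by rewrite mulrC -ltr_pdivrMr// truncnS_gt.
exists (2 ^+ K), (1 - q / 2); split; [by rewrite exprn_ge0|lra|lra|move=> n].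
have q01 : 0 <= q <= 1 by rewrite ltW.
apply: (@le_trans _ _ (partial_sum_cdf p n K)%:E); last first.
  by rewrite lee_fin partial_sum_cdf_bernoulli_le.
rewrite -(partial_sum_lt_prob mX iX pX); apply: le_measure.
- by rewrite inE; apply: measurableC; exact: measurable_acc_info_gt.
- by rewrite inE; exact: measurable_partial_sum_lt.
move=> w /= /negP; rewrite -leNgt => h.
rewrite -(ltr_nat R) -(ltr_pM2l c0); apply: le_lt_trans Kc; apply: le_trans h.
rewrite natr_sum big_distrr/= /acc_info; apply: ler_sum => i _.
rewrite /X; case: ltP => ezi; last by rewrite mulr0 log2_ge0.
rewrite mulr1 /c /log2 ler_wpM2r ?invr_ge0 ?ln_ge0 ?ler1n//.
have Se : 0 < SNR * e by rewrite mulr_gt0.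
have Sez : SNR * e <= SNR * z i w by rewrite ler_wpM2l ?ltW.
by rewrite ler_ln ?posrE; lra.
Qed.

Lemma measurable_harq_time n :
  measurable ((fun w => harq_time Rate SNR (fun i => z i w)) @^-1` [set n]).
Proof.
have mB := measurable_acc_info_gt.
case: n => [|n].
  rewrite (_ : _ @^-1` _ =
    \bigcap_m ~` [set w | Rate < acc_info SNR (fun i => z i w) m]).
    by apply: bigcap_measurableType => m _; exact: measurableC.
  apply/seteqP; split => w.
    by move=> /(harq_timeP SNR0 Rate0 (z0^~ w)) h m _; exact/negP.
  by move=> h; apply/(harq_timeP SNR0 Rate0 (z0^~ w)) => m; apply/negP; exact: h.
rewrite (_ : _ @^-1` _ = ~` [set w | Rate < acc_info SNR (fun i => z i w) n] `&`
    [set w | Rate < acc_info SNR (fun i => z i w) n.+1]).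
  by apply: measurableI => //; exact: measurableC.
apply/seteqP; split => w.
  by move=> /(harq_timeP SNR0 Rate0 (z0^~ w)) [/negP h1 h2].
by move=> [/negP h1 h2]; exact/(harq_timeP SNR0 Rate0 (z0^~ w)).
Qed.

Lemma harq_time_tail : exists C r : R, [/\ 0 <= C, 0 < r, r < 1 &
  forall n, (P ((fun w => harq_time Rate SNR (fun i => z i w)) @^-1` [set n]) <=
    (C * r ^+ n)%:E)%E].
Proof.
have [C [r [C0 r0 r1 tail]]] := acc_info_le_tail.
(* [T = n + 1] only says that [n] blocks were not enough, so [C r^n] is written as
   [(C / r) r^{n+1}]. *)
exists (C / r), r; split => // [|n]; first by rewrite divr_ge0// ltW.
have mono m : (forall w, harq_time Rate SNR (fun i => z i w) = n ->
      ~~ (Rate < acc_info SNR (fun i => z i w) m)) ->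
    (P ((fun w => harq_time Rate SNR (fun i => z i w)) @^-1` [set n]) <= (C * r ^+ m)%:E)%E.
  move=> h; apply: le_trans (tail m); apply: le_measure.
  - by rewrite inE; exact: measurable_harq_time.
  - by rewrite inE; apply: measurableC; exact: measurable_acc_info_gt.
  - by move=> w /= /h /negP.
case: n mono => [|n] mono.
  apply: le_trans (mono 0%N _) _.
    by move=> w /(harq_timeP SNR0 Rate0 (z0^~ w)).
  by rewrite lee_fin !expr0 !mulr1 ler_peMr// invf_ge1// ltW.
apply: le_trans (mono n _) _.
  by move=> w /(harq_timeP SNR0 Rate0 (z0^~ w))[].
by rewrite exprS mulrA divfK// gt_eqF.
Qed.

(** The default value 0 entails insufficient information after [m] blocks for every [m], and these
    probabilities tend to 0. *)
Lemma harq_time_neq0 :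
  P ((fun w => harq_time Rate SNR (fun i => z i w)) @^-1` [set 0%N]) = 0%E.
Proof.
have [C [r [C0 r0 r1 tail]]] := acc_info_le_tail.
have mono m : (P ((fun w => harq_time Rate SNR (fun i => z i w)) @^-1` [set 0%N]) <=
    (C * r ^+ m)%:E)%E.
  apply: le_trans (tail m); apply: le_measure.
  - by rewrite inE; exact: measurable_harq_time.
  - by rewrite inE; apply: measurableC; exact: measurable_acc_info_gt.
  - by move=> w /= /(harq_timeP SNR0 Rate0 (z0^~ w)) /(_ m) /negP.
apply/eqP; rewrite eq_le measure_ge0 andbT.
have fP : P ((fun w => harq_time Rate SNR (fun i => z i w)) @^-1` [set 0%N]) \is a fin_num.
  by apply: fin_num_measure; exact: measurable_harq_time.
rewrite -(fineK fP) lee_fin.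
have c : C * r ^+ m @[m --> \oo] --> (0 : R).
  by apply: cvg_geometric; rewrite gtr0_norm.
rewrite -(cvg_lim _ c)//; apply: limr_ge; first exact: cvgP c.
by apply: nearW => m; rewrite -lee_fin (fineK fP).
Qed.
End harq_tail.

Lemma geometric_tail_expR (R : realType) (p : nat -> R) (C r : R) :
  0 <= C -> 0 < r -> r < 1 -> (forall n, 0 <= p n <= C * r ^+ n) ->
  exists2 b : R, 0 < b & cvgn (series (fun n => p n * expR ((b + b) * n%:R))).
Proof.
move=> C0 r0 r1 pC; have lr : ln r < 0 by rewrite ln_lt0// r0.
(* Then [2 b = - ln r / 2], and the terms are at most [C] times the powers of the square root of
   [r]. *)
exists (- ln r / 4); first by lra.
have x1 : `|expR (ln r / 2)| < 1.
  by rewrite ger0_norm ?expR_ge0// -[ltRHS]expR0 ltr_expR; lra.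
apply: (@series_le_cvg R _ (geometric C (expR (ln r / 2)))); last first.
  exact: is_cvg_geometric_series.
all: move=> n /=; have /andP[p0 pn] := pC n.
- apply: (le_trans (ler_wpM2r (expR_ge0 _) pn)).
  rewrite -mulrA ler_wpM2l// -{1}(@lnK _ r)// -!expRM_natl -expRD ler_expR.
  by rewrite le_eqVlt; apply/orP; left; apply/eqP; field.
- by rewrite mulr_ge0// expR_ge0.
- by rewrite mulr_ge0// exprn_ge0// expR_ge0.
Qed.

(** * Effective capacity expansion for HARQ transmission times *)

Unset Implicit Arguments.
Set Strict Implicit.

Theorem theorem1 (d : measure_display) (Om : measurableType d) (R : realType)
  (P : probability Om R) (SNR Rate : R)
  (z : nat -> Om -> R) (TT : nat -> Om -> nat) :
  0 < SNR -> 0 < Rate ->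
  (* z_1, z_2, ... : i.i.d. nonnegative random variables *)
  (forall i, measurable_fun setT (z i)) ->
  (forall i w, 0 <= z i w) ->
  mutually_independent_R P z ->
  (forall i (A : set R), measurable A -> P (z i @^-1` A) = P (z 0%N @^-1` A)) ->
  (* non-degenerate fading: otherwise T is almost surely undefined *)
  (0 < P [set w | (0 < z 0%N w)%R])%E ->
  (* T_1, T_2, ... : i.i.d. copies of T *)
  (forall l (n : nat), measurable (TT l @^-1` [set n])) ->
  mutually_independent_nat P TT ->
  (forall l (A : set nat),
     P (TT l @^-1` A) =
     P ((fun w => harq_time Rate SNR (fun i => z i w)) @^-1` A)) ->
  exists mu1 sigma2 : R,
    'E_P[fun w => (harq_time Rate SNR (fun i => z i w))%:R]%E = mu1%:E /\
    'V_P[fun w => (harq_time Rate SNR (fun i => z i w))%:R]%E = sigma2%:E /\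
    exists delta : R, 0 < delta /\
    exists Ce : R -> R,
      (forall theta, 0 < theta < delta ->
         (- (1 / (theta * t)) *
            ln (fine 'E_P[fun w =>
                  expR (- theta * Rate *
                        (renewal_count (fun l => TT l w) t)%:R)]%E))
           @[t --> +oo] --> Ce theta) /\
      ((Ce theta - (Rate / mu1 - Rate ^+ 2 * sigma2 / (2 * mu1 ^+ 3) * theta))
         / theta) @[theta --> 0^'+] --> 0.
Proof.
move=> SNR0 Rate0 mz z0 iz ez pz mT iT eT.
pose X w := harq_time Rate SNR (fun i => z i w).
pose p n := fine (P (X @^-1` [set n])).
have mX n : measurable (X @^-1` [set n]) by exact: measurable_harq_time.
have pX n : P (X @^-1` [set n]) = (p n)%:E by rewrite fineK// fin_num_measure.
have pT l n : P (TT l @^-1` [set n]) = (p n)%:E by rewrite eT.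
have p0 n : 0 <= p n by rewrite fine_ge0.
have p00 : p 0%N = 0 by rewrite /p harq_time_neq0.
have p1 : series p @ \oo --> (1 : R) by exact: cvg_series_mass mX pX.
have [b b0 pb] : exists2 b : R, 0 < b &
    cvgn (series (fun n => p n * expR ((b + b) * n%:R))).
  have [C [r [C0 r0 r1 tail]]] := harq_time_tail SNR0 Rate0 mz z0 iz ez pz.
  apply: (geometric_tail_expR C0 r0 r1) => n.
  by rewrite p0 -lee_fin -pX tail.
pose mu := moment p 1; pose s2 := moment p 2 - mu ^+ 2.
have mu0 : 0 < mu by apply: lt_le_trans (moment1_ge1 p0 b0 p1 pb p00).
have Emu : ('E_P[fun w => (X w)%:R] = mu%:E)%E.
  apply: (expectation_nat mX pX (f := fun n => n%:R)) => //.
  exact: (is_cvg_moment p0 b0 pb (isT : (0 < 1 <= 3)%N)).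
exists mu, s2; split => //; split.
  rewrite /variance unlock Emu.
  apply: (expectation_nat mX pX (f := fun n => (n%:R - mu) ^+ 2)).
    by move=> n; rewrite sqr_ge0.
  exact: (cvg_series_variance p0 b0 p1 pb).
(* For [a = theta Rate], [theta < delta] is the condition [e^a < 1 + mu b / 2] that keeps the root
   below [b / 2]. *)
pose delta := ln (1 + mu * (b / 2)) / Rate.
have mb : 0 < mu * (b / 2) by rewrite mulr_gt0// divr_gt0.
exists delta; split; first by rewrite divr_gt0// ln_gt0// ltrDl.
(* The witness is the decay rate in [t] of the Laplace transform, divided by [theta]. *)
exists (fun th => mgf_root (mgf p) b (th * Rate) / th); split; last first.
  exact: (mgf_root_scaled_cvg p0 p00 b0 p1 pb Rate0).
move=> th /andP[th0 thd].
have aR : expR (th * Rate) < 1 + mu * (b / 2).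
  rewrite -[ltRHS](@lnK _ (1 + mu * (b / 2))) ?posrE ?addr_gt0//.
  by rewrite ltr_expR -ltr_pdivlMr.
pose nt (t : R) := `|Num.ceil t|%N.
have ntP t : 0 < t -> t <= (nt t)%:R < t + 1.
  move=> t0; have c0 : 0 <= Num.ceil t by rewrite ceil_ge0 (lt_trans _ t0).
  rewrite natr_absz ger0_norm// ceil_ge/=.
  by have := ceilB1_lt t; rewrite intrB ltrBlDr.
have h := renewal_eq_log_cvg p0 p00 b0 p1 pb (mulr_ge0 (ltW th0) (ltW Rate0)) aR th0 ntP
  (fun n => count_laplace_eq (th * Rate) (n := n) p00).
(* For [t > 0] the expectation is [count_laplace] at the ceiling of [t], which suffices for the
   limit at infinity. *)
apply: cvg_trans h; apply: near_eq_cvg; near=> t.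
have t0 : 0 < t by near: t; apply: nbhs_pinfty_gt; exact: num_real.
by rewrite (mulNr th Rate) (expectation_expR_renewal_count mT iT pT p00 t0 (ntP t t0)).
Unshelve. all: by end_near. Qed.
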